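(* Let $m\ge1$, $p>0$ and $k\ge0$ be integers. Then $$V_{(m)}^{\frac{-p}{\sqrt{2m}}+k\sqrt{2m}}(p)=\mathbb C[h_1,h_2,\ldots]\cdot a_0^kv_p.$$
   Context: Fix an integer $m\ge 1$. Let $H$ be the Heisenberg Lie algebra with basis $h_i$, $i\in\mathbb Z$, $[h_i,h_j]=i\,\delta_{i+j,0}$ (the central element acts as $1$). For a scalar $\lambda$ let $H_\lambda$ be the highest weight (Fock) representation with highest weight vector $|\lambda\rangle$: $h_i|\lambda\rangle=0$ for $i>0$, $h_0|\lambda\rangle=\lambda|\lambda\rangle$, and $H_\lambda=\mathbb C[h_{-1},h_{-2},\ldots]|\lambda\rangle$ is free over $\mathbb C[h_{-1},h_{-2},\ldots]$. For $0\le i\le 2m-1$ put $L_{(m),i}=\bigoplus_{n\in\mathbb Z}H_{(2nm+i)/\sqrt{2m}}$. On $\bigoplus_i L_{(m),i}$ the bosonic vertex operator is $$\phi_{\sqrt{2m}}(z)=\exp\Big(\sqrt{2m}\sum_{n>0}\tfrac{h_{-n}}{n}z^n\Big)\exp\Big(-\sqrt{2m}\sum_{n>0}\tfrac{h_{n}}{n}z^{-n}\Big)\,T\,z^{\sqrt{2m}\,h_0}=\sum_{n\in\mathbb Z}a_nz^{-n-1},$$ where $T$ commutes with all $h_i$, $i\ne0$, and $T|\lambda\rangle=|\lambda+\sqrt{2m}\rangle$. The operators $a_n$ pairwise commute. Put $v_p=\left|\frac{-p}{\sqrt{2m}}\right\rangle$ for $p\in\mathbb Z$; then $a_iv_p=0$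 for $i\ge p$. For $p>0$ let $V_{(m)}(p)=\mathbb C[a_{p-1},a_{p-2},\ldots,a_0]\cdot v_p$, and let $V_{(m)}^{c}(p)=\{v\in V_{(m)}(p): h_0v=cv\}$. *)

(* Defs.v *)
From HB Require Import structures.
From mathcomp Require Import all_boot all_order all_algebra.
From mathcomp Require Import finmap monalg.
From mathcomp Require Import complex.
From mathcomp Require Import classical_sets reals.

Set Implicit Arguments.
Unset Strict Implicit.
Unset Printing Implicit Defensive.

Import Order.TTheory GRing.Theory Num.Theory.
Local Open Scope ring_scope.

Definition linext (C : numClosedFieldType) (K : choiceType) (V : lmodType C)
    (f : K -> V) (x : {malg C[K]}) : V :=
  \sum_(b <- msupp x) x@_b *: f b.

(** The direct sum of the L_{(m),i}, 0 <= i < 2m. Since every integer j is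
    uniquely 2nm + i, it is the sum over all integers j of the Fock spaces of
    highest weight j / sqrt(2m). The pair (mu, j) stands for the basis vector
    prod_n h_{-(n+1)}^(mu n) |j / sqrt(2m)>: the variable of index n is
    h_{-(n+1)}. *)
Definition fock_basis : choiceType := ({cmonom nat} * int)%type.

Definition fock (C : numClosedFieldType) : lmodType C := {malg C[fock_basis]}.

Definition rt (C : numClosedFieldType) (m : nat) : C := sqrtC (2 * m)%:R.

(** Locked, since unification otherwise unfolds the finitely supported functions
    when it compares two basis vectors. *)
HB.lock Definition bvec (C : numClosedFieldType) (mu : {cmonom nat}) (j : int) :
    fock C := (<< 1 *g (mu, j) >> : {malg C[fock_basis]}).

(** The highest weight vector |j / sqrt(2m)>. *)
Definition ket (C : numClosedFieldType) (j : int) : fock C := bvec C mone j.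

(** [Negz n] is -(n+1), so h_{-(n+1)} multiplies by the variable of index n;
    h_{n+1} acts as (n+1) d/dh_{-(n+1)}. *)
Definition heis (C : numClosedFieldType) (m : nat) (i : int) :
    fock C -> fock C :=
  linext (fun b : fock_basis =>
    match i with
    | Negz n => bvec C (mmul b.1 (ucm n)) b.2
    | Posz 0 => (b.2%:~R / rt C m) *: bvec C b.1 b.2
    | Posz n.+1 => (n.+1 * b.1 n)%:R *: bvec C (divcm b.1 (ucm n)) b.2
    end).

(** The operator T: adding sqrt(2m) to j / sqrt(2m) adds 2m to j. *)
Definition shift (C : numClosedFieldType) (m : nat) : fock C -> fock C :=
  linext (fun b : fock_basis =>
    bvec C b.1 (b.2 + (2 * m)%:Z)).

(** Coefficient of t^r in (sum_{n > 0} A_n t^n)^k, applied to v. *)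
Fixpoint pow_coef (C : numClosedFieldType) (V : lmodType C)
    (A : nat -> V -> V) (k r : nat) (v : V) : V :=
  if k is k'.+1 then \sum_(1 <= n < r.+1) A n (pow_coef A k' (r - n) v)
  else if r == 0 then v else 0.

(** Coefficient of t^r in exp(sum_{n > 0} A_n t^n), applied to v; the powers
    k > r do not contribute. *)
Definition exp_coef (C : numClosedFieldType) (V : lmodType C)
    (A : nat -> V -> V) (r : nat) (v : V) : V :=
  \sum_(0 <= k < r.+1) (k`!%:R)^-1 *: pow_coef A k r v.

Definition exp_creat (C : numClosedFieldType) (m : nat) :
    nat -> fock C -> fock C :=
  exp_coef (fun n v => (rt C m / n%:R) *: heis m (- n%:Z) v).

Definition exp_annih (C : numClosedFieldType) (m : nat) :
    nat -> fock C -> fock C :=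
  exp_coef (fun n v => - (rt C m / n%:R) *: heis m n%:Z v).

(** The h-degree: h_{-n} has weight n. *)
Definition wt (mu : {cmonom nat}) : nat :=
  (\sum_(n <- finsupp mu) n.+1 * mu n)%N.

(** The operator a_n, i.e. the coefficient of z^(-n-1) in the vertex operator.
    On a basis vector (mu, j) the factor z^(sqrt(2m) h_0) is z^j, so a term with
    z^r from the first exponential and z^(-s) from the second one contributes
    when r - s + j = -n-1. The terms with s > wt mu vanish, because h_i lowers
    the weight by i. *)
Definition mode (C : numClosedFieldType) (m : nat) (n : int) :
    fock C -> fock C :=
  linext (fun b : fock_basis =>
    \sum_(0 <= s < (wt b.1).+1)
      match s%:Z - b.2 - n - 1 with
      | Posz r => exp_creat m r (exp_annih m s (shift m (bvec C b.1 b.2)))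
      | Negz _ => 0
      end).

Definition op_monom (I : choiceType) (V : Type) (A : I -> V -> V)
    (mu : {cmonom I}) (v : V) : V :=
  foldr (fun i w => iter (mu i) (A i) w) v (finsupp mu).

(** C[A_i, i in I] . v for a family of pairwise commuting operators A_i: the
    vectors q(A) v, for q a polynomial in variables indexed by I. As the A_i
    commute, the order of composition in [op_monom] is immaterial. *)
Definition poly_orbit (C : numClosedFieldType) (I : choiceType)
    (V : lmodType C) (A : I -> V -> V) (v : V) : set V :=
  [set w | exists q : {malg C[{cmonom I}]},
             w = linext (fun mu => op_monom A mu v) q]%classic.

Definition vvec (C : numClosedFieldType) (p : int) : fock C := ket C (- p).

Definition Vmp (C : numClosedFieldType) (m p : nat) : set (fock C) :=
  poly_orbit (fun i : 'I_p => mode m (i : nat)%:Z) (vvec C p).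

Definition Vmpc (C : numClosedFieldType) (m p : nat) (c : C) :
    set (fock C) :=
  [set v | Vmp m p v /\ heis m 0 v = c *: v]%classic.

(* Main.v *)
Require Import Defs.
From HB Require Import structures.
From mathcomp Require Import all_boot all_order all_algebra.
From mathcomp Require Import finmap monalg.
From mathcomp Require Import complex classical_sets reals.
From mathcomp Require Import zify.

Set Implicit Arguments.
Unset Strict Implicit.
Unset Printing Implicit Defensive.

Import Order.TTheory GRing.Theory Num.Theory.
Local Open Scope ring_scope.

(** The commutators [h_i, a_n] = sqrt(2m) a_(n+i), valid for every integer i
    ([heis_mode]), turn the claim into a fact about symmetric polynomials.
    Consider the linear map from C[x_1, ..., x_k] to the Fock space that sends
    x_1^n_1 ... x_k^n_k to a_(n_1) ... a_(n_k) v_p. It is invariant under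
    permutations of the x_j because the modes commute ([mode_comm]), so
    symmetric polynomials already fill its image. For i > 0 the operator h_i
    kills v_p, hence corresponds to the multiplication by sqrt(2m) times the
    power sum x_1^i + ... + x_k^i, and a_0^k v_p is the image of 1. In
    characteristic 0 the power sums generate the symmetric polynomials, so
    C[h_1, h_2, ...] a_0^k v_p contains all products of k modes applied to v_p
    ([modes_in_h_orbit]). As each mode raises the eigenvalue of h_0 by sqrt(2m),
    these products are what an h_0-eigenspace of V(p) consists of.
    Conversely a_n v_p = 0 for n >= p, so h_i cannot lead out of the span of the
    products of a_0, ..., a_(p-1) ([Vmp_heis]).

    Both properties of the modes come from one observation
    ([exp_coef_commutator]): if the commutators [D, A_n] are scalars, then D acts
    on exp(sum_n A_n t^n) as a derivation. For D = h_i this gives [heis_mode].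
    It also gives the product of two modes on a highest weight vector: moving the
    annihilating exponential of a(z) past the creating exponential of a(w)
    yields the factor (1 - w/z)^(2m), so that a(z) a(w) |lambda> is (z - w)^(2m)
    times an expression symmetric in z and w ([mode_mode_ket]). Since 2m is even,
    the modes commute on highest weight vectors. The operators h_(-n) generate
    the Fock space from these vectors, and their commutators with the modes are
    again modes; so the modes commute everywhere. *)

(** * Exponentials of families of operators *)

Section Exponential.
Variables (C : numClosedFieldType) (V : lmodType C) (A : nat -> {linear V -> V}).

Fact pow_coef_is_linear k r : linear (pow_coef (fun n => A n) k r).
Proof.
elim: k r => [|k IH] r a u v /=; first by case: eqP => _; rewrite ?scaler0 ?addr0.
rewrite scaler_sumr -big_split; apply: eq_bigr => n _.
by rewrite IH linearP.
Qed.

HB.instance Definition _ k r := GRing.isLinear.Build C V V *:%R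
  (pow_coef (fun n => A n) k r) (pow_coef_is_linear k r).

Fact exp_coef_is_linear r : linear (exp_coef (fun n => A n) r).
Proof.
move=> a u v; rewrite /exp_coef scaler_sumr -big_split; apply: eq_bigr => k _.
by rewrite linearP scalerDr !scalerA mulrC.
Qed.

HB.instance Definition _ r := GRing.isLinear.Build C V V *:%R
  (exp_coef (fun n => A n) r) (exp_coef_is_linear r).

Lemma pow_coef_gt k r v : (r < k)%N -> pow_coef (fun n => A n) k r v = 0.
Proof.
elim: k r => // k IH r lt_rk /=; rewrite big_nat big1 // => n n_range.
by rewrite IH ?linear0 //; lia.
Qed.

Lemma exp_coef_widen N r v : (r < N)%N ->
  exp_coef (fun n => A n) r v =
  \sum_(0 <= k < N) (k`!%:R)^-1 *: pow_coef (fun n => A n) k r v.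
Proof.
move=> lt_rN; rewrite /exp_coef (big_cat_nat _ lt_rN) //=.
rewrite [X in _ = _ + X]big_nat [X in _ = _ + X]big1 ?addr0 // => k /andP[lt_rk _].
by rewrite pow_coef_gt ?scaler0.
Qed.

Lemma exp_coef0 v : exp_coef (fun n => A n) 0 v = v.
Proof. by rewrite /exp_coef big_nat1 /= invr1 scale1r. Qed.

(** Every term but the constant one of the exponential applies some A_n to v
    first. *)
Lemma exp_coef_killed r v : (forall n, (0 < n)%N -> A n v = 0) -> (0 < r)%N ->
  exp_coef (fun n => A n) r v = 0.
Proof.
move=> Av0; have pow0 k s : pow_coef (fun n => A n) k.+1 s v = 0.
  elim: k s => [|k IH] s /=; rewrite big_nat big1 // => n /andP[n_gt0 _].
    by rewrite /=; case: eqP => _; rewrite ?linear0 ?Av0.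
  by move: (IH (s - n)%N) => /= ->; rewrite linear0.
case: r => // r _; rewrite /exp_coef big1 // => -[|k] _; last by rewrite pow0 scaler0.
by rewrite scaler0.
Qed.

Section Commutator.
Variables (D : {linear V -> V}) (kap : C) (i : nat).
Hypothesis i_gt0 : (0 < i)%N.
Hypothesis DA : forall n v, (0 < n)%N -> D (A n v) = A n (D v) + (kap *+ (n == i)) *: v.

(** A derivation sends a^k to k (D a) a^(k-1) when D a is central; here
    D a = kap t^i. *)
Lemma pow_coef_commutator k r v :
  D (pow_coef (fun n => A n) k r v) = pow_coef (fun n => A n) k r (D v) +
    (if (i <= r)%N then (k%:R * kap) *: pow_coef (fun n => A n) k.-1 (r - i) v else 0).
Proof.
elim: k r => [|k IH] r.
  by rewrite mul0r scale0r if_same addr0 /=; case: eqP => _; rewrite ?linear0.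
rewrite [pow_coef _ _ _ _]/= linear_sum.
under eq_big_nat => n n_range do [rewrite DA; last by case/andP: n_range].
rewrite big_split /=.
under eq_bigr => n _ do rewrite IH linearD.
rewrite big_split -addrA /=; congr (_ + _).
have -> : \sum_(1 <= n < r.+1)
    (kap *+ (n == i)) *: pow_coef (fun n => A n) k (r - n) v =
  if (i <= r)%N then kap *: pow_coef (fun n => A n) k (r - i) v else 0.
  case: leqP => [le_ir|lt_ri].
    rewrite (bigD1_seq i) ?iota_uniq ?mem_index_iota ?i_gt0 //= eqxx mulr1n.
    by rewrite big1 ?addr0 // => n /negbTE ->; rewrite scale0r.
  rewrite big_nat big1 // => n n_range.
  have /negbTE -> : n != i by lia.
  by rewrite scale0r.
case: leqP => [le_ir|lt_ri]; last first.
  rewrite addr0 big_nat big1 // => n n_range.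
  by rewrite leqNgt ifF ?linear0 //; lia.
rewrite -[k.+1%:R]natr1 mulrDl mul1r scalerDl; congr (_ + _).
case: k {IH} => [|k] /=.
  rewrite mul0r scale0r big1 // => n _.
  by rewrite scale0r if_same linear0.
rewrite scaler_sumr (@big_cat_nat _ _ _ (r - i).+1) //=; last by lia.
rewrite [X in _ + X]big_nat [X in _ + X]big1 ?addr0; last first.
  by move=> n n_range; rewrite ifF ?linear0 //; lia.
apply: eq_big_nat => n n_range; rewrite ifT; last by lia.
by rewrite linearZ; congr (_ *: A n (pow_coef _ _ _ _)); lia.
Qed.

(** In generating functions, [D, exp(sum_n A_n t^n)] = kap t^i exp(sum_n A_n t^n). *)
Lemma exp_coef_commutator r v :
  D (exp_coef (fun n => A n) r v) = exp_coef (fun n => A n) r (D v) +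
    (if (i <= r)%N then kap *: exp_coef (fun n => A n) (r - i) v else 0).
Proof.
rewrite /exp_coef linear_sum.
under eq_bigr => k _ do rewrite linearZ /= pow_coef_commutator scalerDr.
rewrite big_split; congr (_ + _).
case: leqP => [le_ir|_]; last by rewrite big1 // => k _; rewrite scaler0.
rewrite -!/(exp_coef _ _ _) (@exp_coef_widen r (r - i)); last by lia.
rewrite big_nat_recl //= mul0r scale0r scaler0 add0r scaler_sumr.
apply: eq_bigr => k _; rewrite !scalerA; congr (_ *: _).
by rewrite factS natrM invfM mulrACA mulVf ?mul1r 1?mulrC // pnatr_eq0.
Qed.
End Commutator.

Lemma exp_coef_comm (D : {linear V -> V}) r v :
    (forall n v, (0 < n)%N -> D (A n v) = A n (D v)) ->
  D (exp_coef (fun n => A n) r v) = exp_coef (fun n => A n) r (D v).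
Proof.
move=> DA; rewrite (@exp_coef_commutator D 0 1) //.
  by rewrite scale0r if_same addr0.
by move=> n w n_gt0; rewrite mul0rn scale0r addr0 DA.
Qed.

Hypothesis A_comm : forall n l v, (0 < n)%N -> (0 < l)%N -> A n (A l v) = A l (A n v).

(** The derivation t d/dt applied to a(t)^(k+1). *)
Lemma pow_coef_euler k r v :
  r%:R *: pow_coef (fun n => A n) k.+1 r v =
  k.+1%:R *: \sum_(1 <= n < r.+1) n%:R *: A n (pow_coef (fun n => A n) k (r - n) v).
Proof.
elim: k r => [|k IH] r.
  rewrite scale1r /= scaler_sumr; apply: eq_big_nat => n n_range.
  have [e|_] := eqVneq (r - n)%N 0%N; last by rewrite linear0 !scaler0.
  by have -> : r = n by lia.
rewrite -natr1 addrC scalerDl scale1r.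
have -> : r%:R *: pow_coef (fun n => A n) k.+2 r v =
  \sum_(1 <= n < r.+1) (n%:R *: A n (pow_coef (fun n => A n) k.+1 (r - n) v) +
    A n ((r - n)%:R *: pow_coef (fun n => A n) k.+1 (r - n) v)).
  rewrite [pow_coef _ k.+2 _ _]/= scaler_sumr; apply: eq_big_nat => n n_range.
  by rewrite linearZ -scalerDl -natrD subnKC //; lia.
rewrite big_split; congr (_ + _).
under eq_bigr => n _ do rewrite IH linearZ.
rewrite /= -scaler_sumr; congr (_ *: _).
under [LHS]eq_bigr => n _ do rewrite linear_sum.
under [RHS]eq_bigr => n _ do rewrite linear_sum scaler_sumr.
(* The bounds of the double sum are made independent of one another, so that it
   can be exchanged. *)
have widen F : \sum_(1 <= n < r.+1) \sum_(1 <= l < (r - n).+1) F n l =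
  \sum_(1 <= n < r.+1) \sum_(1 <= l < r.+1 | (n + l <= r)%N) F n l :> V.
  apply: eq_big_nat => n n_range; rewrite (@big_nat_widen _ _ _ _ _ r.+1) ?ltnS ?leq_subr //.
  by rewrite big_nat_cond [RHS]big_nat_cond; apply: eq_bigl => l; lia.
rewrite !widen [RHS](exchange_big_dep_nat xpredT) //=.
apply: eq_big_nat => l l_range; rewrite big_nat_cond [RHS]big_nat_cond.
apply: eq_big => [n|n n_range]; first by lia.
have -> : (r - l - n = r - n - l)%N by lia.
by rewrite linearZ A_comm //; lia.
Qed.

(** The derivation t d/dt applied to exp(a(t)). *)
Lemma exp_coef_euler r v :
  r%:R *: exp_coef (fun n => A n) r v =
  \sum_(1 <= n < r.+1) n%:R *: A n (exp_coef (fun n => A n) (r - n) v).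
Proof.
case: r => [|r]; first by rewrite scale0r big_geq.
have -> : \sum_(1 <= n < r.+2) n%:R *: A n (exp_coef (fun n => A n) (r.+1 - n) v) =
  \sum_(1 <= n < r.+2) \sum_(0 <= k < r.+1)
    (k`!%:R)^-1 *: (n%:R *: A n (pow_coef (fun n => A n) k (r.+1 - n) v)).
  apply: eq_big_nat => n n_range; rewrite (@exp_coef_widen r.+1); last by lia.
  rewrite linear_sum scaler_sumr; apply: eq_bigr => k _.
  by rewrite linearZ /= !scalerA mulrC.
rewrite exchange_big /exp_coef [in LHS]big_nat_recl // scaler0 add0r scaler_sumr.
apply: eq_bigr => k _; rewrite -scaler_sumr scalerA mulrC -scalerA pow_coef_euler.
by rewrite scalerA factS natrM invfM mulrAC mulVf ?mul1r // pnatr_eq0.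
Qed.
End Exponential.

(** * Linear extension and monomials *)

Section LinearExtension.
Variables (C : numClosedFieldType) (K : choiceType) (V : lmodType C) (f : K -> V).

Lemma linext_widen (d : {fset K}) (x : {malg C[K]}) :
  fsubset (msupp x) d -> linext f x = \sum_(b <- d) x@_b *: f b.
Proof.
move=> le_xd; rewrite /linext (big_fset_incl _ le_xd) //= => b _ b_notin.
by rewrite mcoeff_outdom // scale0r.
Qed.

Fact linext_is_linear : linear (linext f).
Proof.
move=> a x y; pose d := fsetU (msupp x) (msupp y).
have le_d : fsubset (msupp (a *: x + y)) d.
  apply: fsubset_trans (msuppD_le _ _) _.
  by rewrite fsetSU // msuppZ_le.
rewrite (linext_widen le_d) (linext_widen (fsubsetUl (msupp x) (msupp y))).
rewrite (linext_widen (fsubsetUr (msupp x) (msupp y))) scaler_sumr -big_split.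
by apply: eq_bigr => b _; rewrite mcoeffD mcoeffZ scalerDl scalerA.
Qed.

HB.instance Definition _ := GRing.isLinear.Build C {malg C[K]} V *:%R
  (linext f) linext_is_linear.

Lemma linextU b : linext f << b >> = f b.
Proof. by rewrite /linext msuppU oner_eq0 big_seq_fset1 mcoeffUU scale1r. Qed.

Lemma malg_expand (x : {malg C[K]}) : x = \sum_(b <- msupp x) x@_b *: << b >>.
Proof.
rewrite [LHS]monalgE; apply: eq_bigr => b _; apply/malgP => b'.
by rewrite mcoeffZ !mcoeffU; case: eqP => _; rewrite ?mulr1 ?mulr0.
Qed.
End LinearExtension.

Section CommutativeMonomials.
Variable I : choiceType.
Implicit Types (mu : {cmonom I}) (i : I).

Lemma divcmK mu i : (0 < mu i)%N -> mmul (divcm mu (ucm i)) (ucm i) = mu.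
Proof.
move=> mu_i; apply/eqP/cmP => j; rewrite cmM divcmE cmU.
by case: eqP => [<-|_]; lia.
Qed.

Lemma cmonom_ind (P : {cmonom I} -> Prop) :
  P mone -> (forall mu i, P mu -> P (mmul mu (ucm i))) -> forall mu, P mu.
Proof.
move=> P1 PM mu; have [n] := ubnP (mdeg mu); elim: n mu => // n IH mu lt_mu.
have [/mdeg_eq0I -> //|mu_neq0] := eqVneq (mdeg mu) 0%N.
have [i mu_i] : exists i, (0 < mu i)%N.
  have [d0|ne] := eqVneq (finsupp mu) fset0.
    by move: mu_neq0; rewrite mdegE d0 big_seq_fset0.
  by case/fset0Pn: ne => i; rewrite -cmE_neq0 -lt0n; exists i.
rewrite -(divcmK mu_i); apply/PM/IH.
by move: lt_mu; rewrite -{1}(divcmK mu_i) mdegM mdegU; lia.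
Qed.
End CommutativeMonomials.

Lemma wtM (mu : {cmonom nat}) i : wt (mmul mu (ucm i)) = (wt mu + i.+1)%N.
Proof.
pose d := fsetU (finsupp mu) (fset1 i).
have widen (nu : {cmonom nat}) : fsubset (finsupp nu) d ->
    wt nu = (\sum_(n <- d) n.+1 * nu n)%N.
  move=> le_d; rewrite /wt (big_fset_incl _ le_d) //= => n _.
  by rewrite -cmE_eq0 => /eqP ->; rewrite muln0.
rewrite !widen ?fsubsetUl //; last by rewrite mdomD mdomU.
under eq_bigr => n _ do rewrite cmM cmU mulnDr.
rewrite big_split /=; congr (_ + _)%N.
rewrite (big_fsetD1 i) ?inE ?eqxx ?orbT //= muln1 big1_fset ?addn0 // => n.
by rewrite !inE eq_sym => /andP[/negbTE -> _] _; rewrite muln0.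
Qed.

Lemma wt1 : wt mone = 0%N.
Proof. by rewrite /wt mdom1 big_seq_fset0. Qed.

(** * The Heisenberg operators *)

Section Fock.
Variables (C : numClosedFieldType) (m : nat).
Local Notation fock := (fock C).
Local Notation h := (@heis C m).
Local Notation rt := (rt C m).
Local Notation ket := (ket C).
Local Notation bvec := (bvec C).
Implicit Types (u v w : fock) (mu : {cmonom nat}) (i j n r s : nat).

Lemma sqr_rt : rt * rt = (2 * m)%:R.
Proof. by rewrite -expr2 sqrtCK. Qed.

Lemma linext_bvec (f : fock_basis -> fock) mu (c : int) :
  linext f (bvec mu c) = f (mu, c).
Proof. by rewrite bvec.unlock linextU. Qed.

HB.instance Definition _ (c : int) := GRing.isLinear.Build C fock fock *:%R (h c)
  (linext_is_linear _).
HB.instance Definition _ := GRing.isLinear.Build C fock fock *:%R (@shift C m)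
  (linext_is_linear _).
HB.instance Definition _ (c : int) := GRing.isLinear.Build C fock fock *:%R (@mode C m c)
  (linext_is_linear _).

Lemma bvec_expand v : v = \sum_(b <- msupp (v : {malg C[fock_basis]}))
  (v : {malg C[fock_basis]})@_b *: bvec b.1 b.2.
Proof.
rewrite [LHS]malg_expand bvec.unlock.
by apply: eq_bigr => b _; rewrite -surjective_pairing.
Qed.

Lemma bvec_ind (Q : fock -> Prop) :
    (forall a u v, Q u -> Q v -> Q (a *: u + v)) ->
  (forall mu (c : int), Q (bvec mu c)) -> forall v, Q v.
Proof.
move=> Qlin Qb v; rewrite (bvec_expand v).
elim: (enum_fset _) => [|b s IH]; last by rewrite big_cons; apply: Qlin.
rewrite big_nil; have := Qlin (-1) _ _ (Qb mone 0) (Qb mone 0).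
by rewrite scaleN1r addNr.
Qed.

Lemma heis_creat n mu c : h (Negz n) (bvec mu c) = bvec (mmul mu (ucm n)) c.
Proof. by rewrite /heis linext_bvec. Qed.

Lemma heis_zero mu (c : int) : h 0 (bvec mu c) = (c%:~R / rt) *: bvec mu c.
Proof. by rewrite /heis linext_bvec. Qed.

Lemma heis_annih n mu c :
  h (Posz n.+1) (bvec mu c) = (n.+1 * mu n)%:R *: bvec (divcm mu (ucm n)) c.
Proof. by rewrite /heis linext_bvec. Qed.

Lemma shift_bvec mu (c : int) : shift m (bvec mu c) = bvec mu (c + (2 * m)%:Z).
Proof. by rewrite /shift linext_bvec. Qed.

(** Operators are controlled on the whole Fock space by their values on the
    highest weight vectors and their commutators with the h_(-n), n > 0. *)
Lemma fock_ind (Q : fock -> Prop) :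
    (forall a u v, Q u -> Q v -> Q (a *: u + v)) -> (forall c : int, Q (ket c)) ->
  (forall n v, Q v -> Q (h (Negz n) v)) -> forall v, Q v.
Proof.
move=> Qlin Qket Qh; apply: bvec_ind => // mu c; elim/cmonom_ind: mu => [|mu n].
  exact: Qket.
by rewrite -heis_creat; apply: Qh.
Qed.

Lemma heis_ket n (c : int) : h n.+1 (ket c) = 0.
Proof. by rewrite heis_annih cm1 muln0 scale0r. Qed.

Lemma heis_comm (a b : int) v :
  h a (h b v) = h b (h a v) + (if a + b == 0 then a%:~R else 0) *: v.
Proof.
elim/bvec_ind: v => [x u v hu hv|mu c].
  rewrite !linearP /= hu hv !scalerDr !scalerA -!addrA; congr (_ + _).
  by rewrite addrCA.
have annih_creat (a' b' : nat) : h a'.+1 (h (Negz b') (bvec mu c)) =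
    h (Negz b') (h a'.+1 (bvec mu c)) +
    (if a'.+1%:Z + Negz b' == 0 then a'.+1%:~R else 0) *: bvec mu c.
  rewrite heis_creat !heis_annih linearZ /= heis_creat cmM cmU.
  have -> : (a'.+1%:Z + Negz b' == 0) = (b' == a') by lia.
  have [->|ne] := eqVneq b' a'; last first.
    rewrite addn0 scale0r addr0; have [->|mu_a] := posnP (mu a').
      by rewrite muln0 !scale0r.
    congr (_ *: bvec _ _); apply/eqP/cmP => i; rewrite !(divcmE, cmM, cmU).
    by case: (eqVneq a' i) ne mu_a => [<-|_] /=; case: eqVneq; lia.
  have -> : divcm (mmul mu (ucm a')) (ucm a') = mu.
    by apply/eqP/cmP => i; rewrite divcmE cmM addnK.
  have [->|mu_a] := posnP (mu a').
    by rewrite muln0 scale0r add0r muln1.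
  by rewrite divcmK // -scalerDl -natrD mulnDr muln1.
case: a b => [[|a]|a] [[|b]|b].
- by rewrite scale0r addr0.
- rewrite add0r /= scale0r addr0 heis_annih heis_zero !linearZ /=.
  by rewrite heis_annih heis_zero !scalerA mulrC.
- by rewrite add0r /= scale0r addr0 heis_creat !heis_zero linearZ /= heis_creat.
- have -> : (a.+1%:Z + 0%Z == 0) = false by lia.
  rewrite scale0r addr0 heis_annih heis_zero !linearZ /=.
  by rewrite heis_annih heis_zero !scalerA mulrC.
- rewrite /= scale0r addr0 !heis_annih !linearZ /= !heis_annih !scalerA.
  rewrite -!natrM !divcmE !cmU.
  congr (_%:R *: bvec _ _); last by apply/eqP/cmP => i; rewrite !divcmE !cmU; lia.
  case: (eqVneq a b) => [->|_] //=.
  by rewrite !subn0 mulnC.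
- exact: annih_creat.
- have -> : (Negz a + 0%Z == 0) = false by lia.
  by rewrite scale0r addr0 heis_creat !heis_zero linearZ /= heis_creat.
- rewrite annih_creat -addrA -scalerDl addrC [Negz a + _]addrC.
  case: eqP => e; last by rewrite addr0 scale0r add0r.
  have -> : a = b by lia.
  by rewrite NegzE rmorphN /= subrr scale0r add0r.
by rewrite !heis_creat /= scale0r addr0 -!mulmA [mmul (ucm b) _]mulmC.
Qed.

Hypothesis m_gt0 : (0 < m)%N.

Lemma rt_neq0 : rt != 0.
Proof. by rewrite sqrtC_eq0 pnatr_eq0; lia. Qed.

(** Among the Heisenberg operators, only h_0 sees the weight that T shifts. *)
Lemma heis_shift (a : int) v :
  h a (shift m v) = shift m (h a v) + (if a == 0 then rt else 0) *: shift m v.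
Proof.
elim/bvec_ind: v => [x u v hu hv|mu c].
  rewrite !linearP /= hu hv !scalerDr -!addrA; congr (_ + _).
  by rewrite addrCA.
rewrite shift_bvec; case: a => [[|n]|n].
- rewrite !heis_zero linearZ /= shift_bvec -scalerDl intrD mulrDl; congr ((_ + _) *: _).
  have -> : (2 * m)%:Z%:~R = rt * rt by rewrite sqr_rt.
  by rewrite mulfK ?rt_neq0.
- by rewrite scale0r addr0 !heis_annih linearZ /= shift_bvec.
- by rewrite scale0r addr0 !heis_creat shift_bvec.
Qed.

(** * The two exponentials of the vertex operator *)

Definition creation n : fock -> fock := fun v => (rt / n%:R) *: h (- n%:Z) v.
Definition annihilation n : fock -> fock := fun v => - (rt / n%:R) *: h n%:Z v.

Fact creation_is_linear n : linear (creation n).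
Proof. by move=> a u v; rewrite /creation linearP scalerDr !scalerA mulrC. Qed.
Fact annihilation_is_linear n : linear (annihilation n).
Proof. by move=> a u v; rewrite /annihilation linearP scalerDr !scalerA mulrC. Qed.

HB.instance Definition _ n := GRing.isLinear.Build C fock fock *:%R
  (creation n) (creation_is_linear n).
HB.instance Definition _ n := GRing.isLinear.Build C fock fock *:%R
  (annihilation n) (annihilation_is_linear n).

HB.instance Definition _ r := GRing.isLinear.Build C fock fock *:%R (@exp_creat C m r)
  (exp_coef_is_linear (fun n => creation n) r).
HB.instance Definition _ r := GRing.isLinear.Build C fock fock *:%R (@exp_annih C m r)
  (exp_coef_is_linear (fun n => annihilation n) r).

Lemma exp_creat_comm (a : int) r v : a <= 0 ->
  h a (exp_creat m r v) = exp_creat m r (h a v).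
Proof.
move=> a_le0; apply: (@exp_coef_comm _ _ (fun n => creation n) (h a)) => n w n_gt0.
rewrite /creation linearZ /= heis_comm ifF; last by lia.
by rewrite scale0r addr0.
Qed.

Lemma heis_exp_creat n r v : h n.+1 (exp_creat m r v) =
  exp_creat m r (h n.+1 v) + (if (n < r)%N then rt *: exp_creat m (r - n.+1) v else 0).
Proof.
apply: (@exp_coef_commutator _ _ (fun n => creation n) (h n.+1)) => // l w l_gt0.
rewrite /= /creation linearZ /= heis_comm scalerDr scalerA; congr (_ + _ *: _).
have -> : (n.+1%:Z - l%:Z == 0) = (l == n.+1) by lia.
have [->|_] := eqVneq l n.+1; last by rewrite mulr0.
by rewrite mulfVK // pnatr_eq0.
Qed.

Lemma exp_annih_comm (a : int) r v : 0 <= a ->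
  h a (exp_annih m r v) = exp_annih m r (h a v).
Proof.
move=> a_ge0; apply: (@exp_coef_comm _ _ (fun n => annihilation n) (h a)) => n w n_gt0.
rewrite /annihilation linearZ /= heis_comm ifF; last by lia.
by rewrite scale0r addr0.
Qed.

Lemma heis_exp_annih n r v : h (Negz n) (exp_annih m r v) =
  exp_annih m r (h (Negz n) v) + (if (n < r)%N then rt *: exp_annih m (r - n.+1) v else 0).
Proof.
apply: (@exp_coef_commutator _ _ (fun n => annihilation n) (h (Negz n))) => // l w l_gt0.
rewrite /= /annihilation linearZ /= heis_comm scalerDr scalerA; congr (_ + _ *: _).
have -> : (Negz n + l%:Z == 0) = (l == n.+1) by lia.
have [->|_] := eqVneq l n.+1; last by rewrite mulr0.
by rewrite NegzE rmorphN /= mulrNN mulfVK // pnatr_eq0.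
Qed.

Lemma exp_annih_shift r v : shift m (exp_annih m r v) = exp_annih m r (shift m v).
Proof.
apply: (@exp_coef_comm _ _ (fun n => annihilation n) (@shift C m)) => n w n_gt0.
rewrite /= /annihilation linearZ /= heis_shift ifF; last by lia.
by rewrite scale0r addr0.
Qed.

Lemma exp_creat0 v : exp_creat m 0 v = v.
Proof. exact: (exp_coef0 (fun n => creation n)). Qed.

Lemma exp_annih0 v : exp_annih m 0 v = v.
Proof. exact: (exp_coef0 (fun n => annihilation n)). Qed.

Lemma exp_annih_ket r (c : int) : (0 < r)%N -> exp_annih m r (ket c) = 0.
Proof.
apply: (@exp_coef_killed _ _ (fun n => annihilation n)) => -[|n] // _.
by rewrite /= /annihilation heis_ket scaler0.
Qed.

Lemma exp_creatC r s v :
  exp_creat m r (exp_creat m s v) = exp_creat m s (exp_creat m r v).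
Proof.
apply: (@exp_coef_comm _ _ (fun n => creation n) (@exp_creat C m r)) => n w n_gt0.
rewrite /= /creation linearZ /= exp_creat_comm //; lia.
Qed.

(** Induction on the monomial: commuting h_(-n-1) past the s-th coefficient of
    the annihilating exponential lowers s by n+1, which is also the weight that
    the monomial loses. *)
Lemma exp_annih_bvec mu (c : int) s : (wt mu < s)%N -> exp_annih m s (bvec mu c) = 0.
Proof.
elim/cmonom_ind: mu s => [|mu n IH] s.
  by rewrite wt1 => s_gt0; apply: exp_annih_ket.
rewrite wtM => lt_s; have := heis_exp_annih n s (bvec mu c).
rewrite ifT; last by lia.
by rewrite !IH ?linear0 ?scaler0 ?addr0 ?heis_creat; do ?lia.
Qed.

(** With integer indices the commutator [heis_exp_creatz] has no side condition. *)
Definition exp_creatz (c : int) v : fock :=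
  if c is Posz r then exp_creat m r v else 0.

Fact exp_creatz_is_linear c : linear (exp_creatz c).
Proof.
by case: c => r a u v /=; rewrite ?linearP ?scaler0 ?addr0.
Qed.
HB.instance Definition _ c := GRing.isLinear.Build C fock fock *:%R
  (exp_creatz c) (exp_creatz_is_linear c).

Lemma exp_creatz_comm (a c : int) v : a <= 0 ->
  h a (exp_creatz c v) = exp_creatz c (h a v).
Proof. by case: c => r a_le0 /=; rewrite ?linear0 ?exp_creat_comm. Qed.

Lemma heis_exp_creatz n (c : int) v : h n.+1 (exp_creatz c v) =
  exp_creatz c (h n.+1 v) + rt *: exp_creatz (c - n.+1%:Z) v.
Proof.
case: c => r; last first.
  have -> : Negz r - n.+1%:Z = Negz (r + n.+1)%N by lia.
  by rewrite /= linear0 add0r scaler0.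
rewrite /= heis_exp_creat; congr (_ + _); case: ltnP => [lt_nr|le_rn].
  by have -> : r%:Z - n.+1%:Z = Posz (r - n.+1)%N by lia.
have -> : r%:Z - n.+1%:Z = Negz (n - r)%N by lia.
by rewrite scaler0.
Qed.

Lemma exp_creatzC (c d : int) v :
  exp_creatz c (exp_creatz d v) = exp_creatz d (exp_creatz c v).
Proof.
case: c d => [r|r] [s|s] /=.
- exact: exp_creatC.
- exact: linear0.
- by rewrite linear0.
- by [].
Qed.

(** * Charge *)

(** Stated as an eigenvalue equation and not as a condition on the support, so
    that operators commuting with h_0 visibly preserve it. *)
Definition has_charge (c : int) v := h 0 v = (c%:~R / rt) *: v.

Lemma has_charge_heis c (a : int) v : has_charge c v -> has_charge c (h a v).
Proof.
rewrite /has_charge => hv.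
by rewrite heis_comm hv linearZ /= if_same scale0r addr0.
Qed.

Lemma has_charge_bvec c mu : has_charge c (bvec mu c).
Proof. exact: heis_zero. Qed.

(** Distinct charges have distinct h_0-eigenvalues. *)
Lemma has_charge_coeff (c : int) v (b : fock_basis) : has_charge c v ->
  b \in msupp (v : {malg C[fock_basis]}) -> b.2 = c.
Proof.
move=> hv; rewrite -mcoeff_neq0 => vb_neq0.
have coef : (h 0 v : {malg C[fock_basis]})@_b =
    (b.2%:~R / rt) * (v : {malg C[fock_basis]})@_b.
  elim/bvec_ind: v {hv vb_neq0} => [x u v hu hv|mu d].
    by rewrite linearP !mcoeffD !mcoeffZ hu hv mulrDr mulrCA.
  rewrite heis_zero mcoeffZ bvec.unlock mcoeffU.
  by case: eqP => [<-|_] //; rewrite !mulr0.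
move: coef; rewrite hv mcoeffZ => /(mulIf vb_neq0) /(divIf rt_neq0).
by move/intr_inj.
Qed.

(** * The modes and their commutators with the Heisenberg operators *)

(** The bound on s in the definition of a mode depends on the basis vector. With
    a common bound N the sum is linear, and it computes the mode as soon as N is
    large ([mode_truncE]). *)
Definition mode_trunc N (n c : int) v : fock :=
  \sum_(0 <= s < N) exp_creatz (s%:Z - c - n - 1) (exp_annih m s (shift m v)).

Fact mode_trunc_is_linear N (n c : int) : linear (mode_trunc N n c).
Proof.
move=> a u v; rewrite /mode_trunc scaler_sumr -big_split; apply: eq_bigr => s _.
by rewrite !linearP.
Qed.
HB.instance Definition _ N (n c : int) := GRing.isLinear.Build C fock fock *:%R
  (mode_trunc N n c) (mode_trunc_is_linear N n c).

Lemma mode_trunc_widen M N (n c : int) v : (N <= M)%N ->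
  (forall s, (N <= s)%N -> exp_annih m s v = 0) ->
  mode_trunc M n c v = mode_trunc N n c v.
Proof.
move=> le_NM v0; rewrite /mode_trunc (big_cat_nat _ le_NM) //=.
rewrite [X in _ + X]big_nat [X in _ + X]big1 ?addr0 // => s /andP[le_Ns _].
by rewrite -exp_annih_shift v0 // !linear0.
Qed.

Lemma mode_truncE N (n c : int) v : has_charge c v ->
  (forall s, (N <= s)%N -> exp_annih m s v = 0) -> mode m n v = mode_trunc N n c v.
Proof.
move=> cv v0.
pose M := maxn N (\max_(b <- msupp (v : {malg C[fock_basis]})) (wt b.1).+1).
rewrite -(@mode_trunc_widen M N) ?leq_maxl // [in RHS](bvec_expand v) linear_sum.
rewrite /mode /linext; apply: eq_big_seq => b b_v; rewrite linearZ /=; congr (_ *: _).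
have cb := has_charge_coeff cv b_v.
rewrite (@mode_trunc_widen M (wt b.1).+1).
- by rewrite /mode_trunc cb; apply: eq_bigr => s _; case: (_ - 1).
- rewrite leq_max; apply/orP; right.
  by rewrite (big_rem b) //= leq_maxl.
by move=> s lt_s; apply: exp_annih_bvec.
Qed.

(** Only one factor of the vertex operator contributes to the commutator: the
    creating exponential for a > 0, the annihilating one for a < 0, and T for
    a = 0. *)
Lemma heis_mode (a n : int) v :
  h a (mode m n v) = mode m n (h a v) + rt *: mode m (n + a) v.
Proof.
elim/bvec_ind: v => [x u v hu hv|mu c].
  rewrite !linearP /= hu hv !scalerDr -!addrA; congr (_ + _).
  by rewrite addrCA.
pose N := (wt mu).+1; have b0 s : (N <= s)%N -> exp_annih m s (bvec mu c) = 0.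
  exact: exp_annih_bvec.
have cb := has_charge_bvec c mu.
rewrite [mode m (n + a) _](mode_truncE _ cb b0).
case: (leP 0 a) => [a_ge0|a_lt0].
  rewrite [mode m n (bvec _ _)](mode_truncE _ cb b0) (@mode_truncE N _ c); first last.
  - by move=> s le_s; rewrite -exp_annih_comm // b0 // linear0.
  - exact: has_charge_heis.
  rewrite /mode_trunc linear_sum scaler_sumr -big_split; apply: eq_bigr => s _ /=.
  case: a a_ge0 => [[|i]|//] _.
    rewrite exp_creatz_comm // exp_annih_comm // heis_shift /= !linearD !linearZ /=.
    by rewrite [n + _]addr0.
  rewrite heis_exp_creatz exp_annih_comm // heis_shift /= scale0r addr0.
  by have -> : s%:Z - c - n - 1 - i.+1%:Z = s%:Z - c - (n + i.+1%:Z) - 1 by lia.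
(* The commutator with the annihilating exponential shifts its index by i + 1, so
   the sum for h_(-i-1) runs to N + i + 1. *)
case: a a_lt0 cb => [//|i] _ cb.
have wide s : (N + i.+1 <= s)%N -> exp_annih m s (bvec mu c) = 0.
  by move=> le_s; apply: b0; lia.
rewrite [mode m n (bvec _ _)](mode_truncE _ cb wide).
rewrite (@mode_truncE (N + i.+1) _ c); first last.
- by move=> s lt_s; rewrite heis_creat exp_annih_bvec // wtM; rewrite /N in lt_s; lia.
- exact: has_charge_heis.
rewrite /mode_trunc linear_sum.
under eq_bigr => s _ do
  rewrite /= exp_creatz_comm // heis_exp_annih heis_shift /= scale0r addr0 linearD.
rewrite big_split /=; congr (_ + _).
rewrite (@big_cat_nat _ _ _ i.+1) //=; last by lia.
rewrite big_nat big1 ?add0r => [|s s_range]; last by rewrite ifF ?linear0 //; lia.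
rewrite -{1}[i.+1]add0n big_addn addnK scaler_sumr; apply: eq_bigr => s _.
rewrite ifT; last by lia.
by rewrite linearZ /= addnK; congr (_ *: exp_creatz _ _); lia.
Qed.

(** * Commutation of the modes *)

(** The coefficients of -M t / (1 - t) f = t f' for f = (1 - t)^M. *)
Lemma alternating_binomial_sum (M s : nat) :
  - M%:R * \sum_(0 <= l < s) (-1) ^+ l * 'C(M, l)%:R =
  s%:R * ((-1) ^+ s * 'C(M, s)%:R) :> C.
Proof.
elim: s => [|s IH]; first by rewrite big_geq // mulr0 mul0r.
rewrite big_nat_recr //= mulrDr IH exprS mulN1r !mulNr.
have -> : s.+1%:R * - ((-1) ^+ s * 'C(M, s.+1)%:R) =
    - ((-1) ^+ s * (s.+1 * 'C(M, s.+1))%:R) :> C by rewrite mulrN natrM mulrCA.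
rewrite mul_bin_left; have [le_sM|lt_Ms] := leqP s M.
  by rewrite natrM natrB // mulrBl mulrBr opprB ![_%:R * (_ * _)]mulrCA.
by rewrite bin_small // muln0 !mulr0 subr0 oppr0.
Qed.

(** The factor that appears is the coefficient of t^s in (1 - t)^(2m). By
    [exp_coef_euler] the left-hand sides satisfy the recursion
    s f_s = -2m (f_0 + ... + f_(s-1)), which is the one that [alternating_binomial_sum]
    gives for these coefficients. *)
Lemma exp_annih_creat_ket s t (c : int) :
  exp_annih m s (exp_creat m t (ket c)) =
  if (s <= t)%N
  then ((-1) ^+ s * 'C(2 * m, s)%:R) *: exp_creat m (t - s) (ket c) else 0.
Proof.
have [N] := ubnP s; elim: N s t => // N IH s t lt_s.
have [->|s_gt0] := posnP s.
  by rewrite exp_annih0 leq0n mul1r bin0 scale1r subn0.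
have s_neq0 : s%:R != 0 :> C by rewrite pnatr_eq0 -lt0n.
apply: (scalerI s_neq0).
have -> : s%:R *: exp_annih m s (exp_creat m t (ket c)) =
  \sum_(1 <= n < s.+1)
    n%:R *: annihilation n (exp_annih m (s - n) (exp_creat m t (ket c))).
  apply: (@exp_coef_euler _ _ (fun n => annihilation n)) => n l v n_gt0 l_gt0.
  rewrite /= /annihilation !linearZ /= heis_comm ifF; last by lia.
  by rewrite scale0r addr0 !scalerA mulrC.
have term n : (0 < n < s.+1)%N ->
    n%:R *: annihilation n (exp_annih m (s - n) (exp_creat m t (ket c))) =
    if (s <= t)%N then - (2 * m)%:R *: (((-1) ^+ (s - n) * 'C(2 * m, s - n)%:R) *:
      exp_creat m (t - s) (ket c)) else 0.
  case: n => // n n_range; rewrite /annihilation exp_annih_comm // heis_exp_creat //.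
  rewrite heis_ket linear0 add0r [LHS]scalerA mulrN mulrCA mulfV ?pnatr_eq0 // mulr1.
  case: (ltnP n t) => [lt_nt|le_tn]; last first.
    by rewrite linear0 scaler0 ifF //; lia.
  rewrite linearZ /= [LHS]scalerA mulNr sqr_rt IH; last by lia.
  have -> : (s - n.+1 <= t - n.+1)%N = (s <= t)%N by lia.
  case: ifP => [le_st|_]; last by rewrite scaler0.
  by have -> : (t - n.+1 - (s - n.+1) = t - s)%N by lia.
rewrite (eq_big_nat _ _ term); case: ifP => [le_st|_]; last by rewrite big1 // scaler0.
rewrite -scaler_sumr -scaler_suml !scalerA -alternating_binomial_sum; congr (_ * _ *: _).
rewrite big_nat_rev big_add1 /=; apply: eq_big_nat => l l_range.
by have -> : (s - (1 + s.+1 - l.+2) = l)%N by lia.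
Qed.

Lemma mode_ket (n c : int) : mode m n (ket c) =
  exp_creatz (- c - n - 1) (ket (c + (2 * m)%:Z)).
Proof.
rewrite (@mode_truncE 1 n c); first last.
- by move=> s s_gt0; apply: exp_annih_ket.
- exact: has_charge_bvec.
by rewrite /mode_trunc big_nat1 exp_annih0 shift_bvec add0r.
Qed.

Lemma exp_creatz_charge (r d : int) v :
  has_charge d v -> has_charge d (exp_creatz r v).
Proof. by rewrite /has_charge => hv; rewrite exp_creatz_comm // hv linearZ. Qed.

Lemma exp_creat_shift r v : shift m (exp_creat m r v) = exp_creat m r (shift m v).
Proof.
apply: (@exp_coef_comm _ _ (fun n => creation n) (@shift C m)) => -[//|n] w _.
by rewrite /= /creation linearZ /= heis_shift // scale0r addr0.
Qed.

(** The coefficients of (z - w)^(2m), with both creating exponentials on the left. *)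
Lemma mode_mode_ket (a b c : int) :
  mode m a (mode m b (ket c)) =
  \sum_(0 <= s < (2 * m).+1) ((-1) ^+ s * 'C(2 * m, s)%:R) *:
     exp_creatz (- c - a - 1 + s%:Z - (2 * m)%:Z)
       (exp_creatz (- c - b - 1 - s%:Z) (ket (c + (4 * m)%:Z))).
Proof.
rewrite mode_ket; set c' := c + _; case def_r: (- c - b - 1) => [r|r]; last first.
  rewrite linear0 big1 // => s _.
  have -> : Negz r - s%:Z = Negz (r + s)%N by lia.
  by rewrite !linear0.
(* The bound r + 2m + 1 covers the range of the right-hand side as well. *)
have r0 s : (r.+1 + 2 * m <= s)%N -> exp_annih m s (exp_creat m r (ket c')) = 0.
  by move=> lt_rs; rewrite exp_annih_creat_ket ifF //; lia.
have cr : has_charge c' (exp_creat m r (ket c')).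
  exact: (exp_creatz_charge (Posz r) (has_charge_bvec _ _)).
rewrite /= (mode_truncE a cr r0) /mode_trunc addSn addnC.
rewrite [RHS](@big_nat_widen _ _ _ _ _ (2 * m + r).+1) ?leq_addr ?ltnS //.
rewrite big_mkcond /= [RHS]big_mkcond /=; apply: eq_bigr => s _.
rewrite -exp_annih_shift (exp_annih_creat_ket s r c').
case: (ltnP s (2 * m).+1) => [_|lt_s]; last first.
  by rewrite bin_small // mulr0 scale0r if_same !linear0.
case: leqP => [le_sr|lt_rs]; last first.
  have -> : r%:Z - s%:Z = Negz (s - r.+1) by lia.
  by rewrite !linear0.
have -> : r%:Z - s%:Z = Posz (r - s) by lia.
rewrite !linearZ /= exp_creat_shift shift_bvec.
congr (_ *: exp_creatz _ (exp_creat _ _ (bvec _ _))); rewrite /c'; lia.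
Qed.

(** The substitution of 2m - s for s exchanges a and b in [mode_mode_ket]; the sign
    does not change because 2m is even. *)
Lemma mode_comm_ket (a b c : int) :
  mode m a (mode m b (ket c)) = mode m b (mode m a (ket c)).
Proof.
rewrite !mode_mode_ket big_nat_rev /=; apply: eq_big_nat => s s_range.
rewrite add0n subSS bin_sub; last by lia.
rewrite -signr_odd oddB; last by lia.
rewrite oddM /= signr_odd exp_creatzC.
by congr (_ *: exp_creatz _ (exp_creatz _ _)); lia.
Qed.

(** On h_(-n-1) v, the commutator of a_a and a_b is h_(-n-1) applied to their
    commutator on v, plus multiples of the commutators on v of the pairs
    a_(a-n-1), a_b and a_a, a_(b-n-1). *)
Lemma mode_comm (a b : int) v : mode m a (mode m b v) = mode m b (mode m a v).
Proof.
elim/fock_ind: v a b => [x u v hu hv|c|n v IH] a b; last 1 first.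
- have swap d w : mode m d (h (Negz n) w) =
    h (Negz n) (mode m d w) - rt *: mode m (d + Negz n) w.
    by rewrite heis_mode addrK.
  rewrite !swap !linearB !linearZ /= !swap (IH a b) (IH (a + Negz n)) (IH a (b + _)).
  by rewrite scalerN scalerN [LHS]addrAC.
- by rewrite !linearP /= hu hv.
exact: mode_comm_ket.
Qed.

Lemma mode_ket_eq0 (n c : int) : - c <= n -> mode m n (ket c) = 0.
Proof.
move=> le_cn; rewrite mode_ket; case def_r: (- c - n - 1) => [r|r] //; lia.
Qed.
End Fock.

(** * Orbits of commuting operators *)

Section Subspaces.
Variables (C : numClosedFieldType) (V : lmodType C).

Definition subspace (S : V -> Prop) :=
  S 0 /\ forall a u v, S u -> S v -> S (a *: u + v).

Variables (S : V -> Prop) (S_sub : subspace S).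

Lemma subspaceZ a u : S u -> S (a *: u).
Proof. by case: S_sub => S0 S_lin Su; rewrite -[_ *: u]addr0; apply: S_lin. Qed.

Lemma subspaceB u v : S u -> S v -> S (u - v).
Proof.
by case: S_sub => _ S_lin Su Sv; rewrite addrC -scaleN1r; apply: S_lin.
Qed.

Lemma subspace_sum (T : eqType) (s : seq T) (F : T -> V) :
  (forall x, x \in s -> S (F x)) -> S (\sum_(x <- s) F x).
Proof.
case: S_sub => S0 S_lin SF; rewrite big_seq; elim/big_rec: _ => // x u x_s Su.
by rewrite -[F x]scale1r; apply: S_lin => //; apply: SF.
Qed.

Lemma subspace_linext (K : choiceType) (f : K -> V) (x : {malg C[K]}) :
  (forall b, S (f b)) -> S (linext f x).
Proof. by move=> Sf; apply: subspace_sum => b _; apply: subspaceZ. Qed.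
End Subspaces.

Section Powers.
Variables (C : numClosedFieldType) (V : lmodType C) (D B E : {linear V -> V}).

Fact iter_is_linear n : linear (iter n B).
Proof. by move=> a u v; elim: n => //= n ->; rewrite linearP. Qed.
HB.instance Definition _ n := GRing.isLinear.Build C V V *:%R (iter n B)
  (iter_is_linear n).

(** [D, B^n] = n c B^(n-1) E when [D, B] = c E and E commutes with B. *)
Lemma iter_commutator (c : C) n v :
    (forall w, D (B w) = B (D w) + c *: E w) -> (forall w, E (B w) = B (E w)) ->
  D (iter n B v) = iter n B (D v) + (n%:R * c) *: iter n.-1 B (E v).
Proof.
move=> DB EB; have EBn k w : E (iter k B w) = iter k B (E w).
  by elim: k => //= k <-.
elim: n => [|n IH]; first by rewrite mul0r scale0r addr0.
rewrite /= DB IH linearD linearZ /= EBn -addrA -[n.+1%:R]natr1 mulrDl mul1r scalerDl.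
by case: n {IH} => [|n] //=; rewrite !mul0r !scale0r.
Qed.
End Powers.

Section PolynomialOrbits.
Variables (C : numClosedFieldType) (I : choiceType) (V : lmodType C).
Variables (A : I -> V -> V) (v : V).

Lemma op_monom_ind (S : V -> Prop) (mu : {cmonom I}) :
  S v -> (forall i w, S w -> S (A i w)) -> S (op_monom A mu v).
Proof.
move=> Sv SA; rewrite /op_monom; elim: (enum_fset _) => //= i s IH.
by elim: (mu i) => //= n; apply: SA.
Qed.

Lemma poly_orbit_ind (S : V -> Prop) : subspace S -> S v ->
  (forall i w, S w -> S (A i w)) -> forall w, poly_orbit A v w -> S w.
Proof.
move=> S_sub Sv SA _ [q ->]; apply: subspace_linext => // mu.
exact: op_monom_ind.
Qed.

Lemma poly_orbit_subspace : subspace (poly_orbit A v).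
Proof.
split=> [|a _ _ [q ->] [r ->]]; first by exists 0; rewrite linear0.
by exists (a *: q + r); rewrite linearP.
Qed.

Lemma poly_orbit_monom mu : poly_orbit A v (op_monom A mu v).
Proof. by exists << mu >>; rewrite linextU. Qed.

Lemma poly_orbit_base : poly_orbit A v v.
Proof. by have := poly_orbit_monom mone; rewrite /op_monom mdom1. Qed.

Hypothesis A_lin : forall i, linear (A i).
Hypothesis A_comm : forall i j w, A i (A j w) = A j (A i w).

(** [op_monom] applies the operators in the order in which the support of the
    monomial is enumerated. The next lemmas show that this order is immaterial. *)
Lemma foldr_iterA_rem (g : I -> nat) i (s : seq I) : i \in s ->
  foldr (fun j => iter (g j) (A j)) v s =
  iter (g i) (A i) (foldr (fun j => iter (g j) (A j)) v (rem i s)).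
Proof.
elim: s => // j s IH; rewrite inE /=; case: (eqVneq j i) => [->|_] //= i_s.
rewrite IH //; move: (foldr _ _ _) => w.
elim: (g j) => //= n ->; elim: (g i) => //= k <-; exact: A_comm.
Qed.

Lemma foldr_iterA_perm (g : I -> nat) (s t : seq I) : perm_eq s t ->
  foldr (fun j => iter (g j) (A j)) v s = foldr (fun j => iter (g j) (A j)) v t.
Proof.
elim: s t => [|i s IH] t st; first by rewrite perm_sym in st; rewrite (perm_nilP st).
have i_t : i \in t by rewrite -(perm_mem st) mem_head.
rewrite (foldr_iterA_rem _ i_t) /= (IH (rem i t)) //.
by rewrite -(perm_cons i) (perm_trans st) // perm_to_rem.
Qed.

Lemma op_monomM mu i : op_monom A (mmul mu (ucm i)) v = A i (op_monom A mu v).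
Proof.
rewrite /op_monom.
rewrite (@foldr_iterA_perm _ _ (i :: rem i (finsupp mu))); last first.
  apply: uniq_perm; rewrite ?fset_uniq //=.
    by rewrite mem_rem_uniq ?fset_uniq // inE eqxx /= rem_uniq ?fset_uniq.
  move=> j; rewrite mdomD mdomU !inE mem_rem_uniq ?fset_uniq // !inE.
  by case: eqVneq; rewrite ?orbT ?orbF.
rewrite /= cmM cmU eqxx addn1 iterS; congr (A i _).
have -> : foldr (fun j => iter (mmul mu (ucm i) j) (A j)) v (rem i (finsupp mu)) =
  foldr (fun j => iter (mu j) (A j)) v (rem i (finsupp mu)).
  have : i \notin rem i (finsupp mu) by rewrite mem_rem_uniq ?fset_uniq // inE eqxx.
  elim: (rem _ _) => //= j s IH; rewrite inE negb_or => /andP[/negbTE ij /IH ->].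
  by rewrite cmM cmU ij addn0.
case: (boolP (i \in finsupp mu)) => [i_mu|i_mu].
  by rewrite [RHS](foldr_iterA_rem _ i_mu).
by rewrite rem_id //; move: i_mu; rewrite -cmE_eq0 => /eqP ->.
Qed.

Lemma poly_orbit_stable i w : poly_orbit A v w -> poly_orbit A v (A i w).
Proof.
move=> [q ->]; have [orb0 orb_lin] := poly_orbit_subspace.
apply: (@subspace_linext _ _ (fun u => poly_orbit A v (A i u))) => [|mu].
  split=> [|a u u' uo u'o]; last by rewrite A_lin; apply: orb_lin.
  by rewrite -(subrr 0) -scaleN1r addrC A_lin scaleN1r addNr.
by rewrite -op_monomM; apply: poly_orbit_monom.
Qed.
End PolynomialOrbits.

(** * Products of modes applied to v_p *)

(* Only the relations between these operators matter from here on. *)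
#[local] Opaque heis shift mode exp_creat exp_annih.

Section ModeProducts.
Variables (C : numClosedFieldType) (m p : nat).
Hypothesis m_gt0 : (0 < m)%N.
Local Notation h := (@heis C m).
Local Notation rt := (rt C m).
Local Notation a_ n := (@mode C m n).
Local Notation vp := (vvec C p%:Z).
Local Notation h_orbit k :=
  (poly_orbit (fun n : nat => @heis C m n.+1%:Z) (iter k (mode m 0) vp)).

Definition modes (l : seq nat) : fock C := foldr (fun n : nat => a_ n%:Z) vp l.

(** On lists of exponents, the expansion of the product of a monomial by the power
    sum of degree d. *)
Fixpoint bumps (d : nat) (l : seq nat) : seq (seq nat) :=
  if l is i :: l' then ((i + d)%N :: l') :: map (cons i) (bumps d l') else [::].

Lemma size_bumps d l l' : l' \in bumps d l -> size l' = size l.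
Proof.
elim: l l' => // i l IH l'; rewrite inE => /orP[/eqP ->//|/mapP[l'' l''_in ->]].
by rewrite /= (IH l'').
Qed.

Lemma heis_modes d l :
  h d.+1 (modes l) = rt *: \sum_(l' <- bumps d.+1 l) modes l'.
Proof.
elim: l => [|i l IH] /=; first by rewrite big_nil scaler0 heis_ket.
rewrite big_cons big_map heis_mode // IH linearZ /= (linear_sum (a_ i)).
by rewrite -scalerDr addrC.
Qed.

Lemma heis_iter_mode0 z d v : h d.+1 (iter z (a_ 0) v) =
  iter z (a_ 0) (h d.+1 v) + (z%:R * rt) *: iter z.-1 (a_ 0) (a_ d.+1 v).
Proof.
apply: (iter_commutator (D := h d.+1) (B := a_ 0) (E := a_ d.+1)) => w.
  by rewrite /= heis_mode // add0r.
exact: mode_comm.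
Qed.

Lemma h_orbit_stable k n w : h_orbit k w -> h_orbit k (h n.+1 w).
Proof.
apply: (@poly_orbit_stable _ _ _ (fun n : nat => h n.+1%:Z)) => [i|i j u].
  exact: linearP.
by rewrite /= heis_comm (_ : (i.+1%:Z + j.+1%:Z == 0) = false) ?scale0r ?addr0.
Qed.

(** The power sums generate the symmetric polynomials: the product of a power sum
    of degree d+1 with the symmetrization of the monomial with exponents
    (0^(z+1), l) is (z+1) times the one with exponents (0^z, d+1, l), plus terms
    where an entry of l has grown. The latter have z+1 zeros besides as many
    entries as l, so induction on the size of l applies to them. *)
Lemma modes_in_h_orbit l z : h_orbit (z + size l)%N (iter z (a_ 0) (modes l)).
Proof.
have [n] := ubnP (size l); elim: n l z => // n IH [|[|d] l] z le_ln.
- by rewrite addn0; apply: poly_orbit_base.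
- by rewrite /= -iterSr addnS -addSn; apply: IH.
pose orb := h_orbit (z + size (d.+1 :: l))%N.
have orb_sub : subspace orb by apply: poly_orbit_subspace.
have IHl l' : size l' = size l -> orb (iter z.+1 (a_ 0) (modes l')).
  by move=> eq_l; rewrite /orb [size _]/= -eq_l addnS -addSn; apply: IH; rewrite eq_l.
have c_neq0 : z.+1%:R * rt != 0 by rewrite mulf_neq0 ?rt_neq0 // pnatr_eq0.
suff orb_c : orb ((z.+1%:R * rt) *: iter z (a_ 0) (modes (d.+1 :: l))).
  by have := subspaceZ orb_sub (z.+1%:R * rt)^-1 orb_c; rewrite scalerK.
have -> : (z.+1%:R * rt) *: iter z (a_ 0) (modes (d.+1 :: l)) =
    h d.+1 (iter z.+1 (a_ 0) (modes l)) - iter z.+1 (a_ 0) (h d.+1 (modes l)).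
  by rewrite heis_iter_mode0 addrAC subrr add0r.
apply: (subspaceB orb_sub); first by apply/h_orbit_stable/IHl.
rewrite heis_modes linearZ (linear_sum (iter z.+1 (a_ 0))); apply: (subspaceZ orb_sub).
by apply: (subspace_sum orb_sub) => l' /size_bumps /IHl.
Qed.

Definition charge_part (c : int) : fock C -> fock C :=
  linext (fun b : fock_basis => if b.2 == c then bvec C b.1 b.2 else 0).
HB.instance Definition _ c := GRing.isLinear.Build C (fock C) (fock C) *:%R
  (charge_part c) (linext_is_linear _).

Lemma charge_partE (c d : int) v : has_charge m d v ->
  charge_part c v = if d == c then v else 0.
Proof.
move=> dv; rewrite /charge_part /linext big_seq.
under eq_bigr => b b_v do rewrite (has_charge_coeff m_gt0 dv b_v).
case: eqP => [_|_]; last by rewrite big1 // => b _; rewrite scaler0.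
rewrite [RHS]bvec_expand [RHS]big_seq; apply: eq_bigr => b b_v.
by rewrite (has_charge_coeff m_gt0 dv b_v).
Qed.

Lemma has_charge_mode (c n : int) v :
  has_charge m c v -> has_charge m (c + (2 * m)%:Z) (a_ n v).
Proof.
rewrite /has_charge => cv; rewrite heis_mode // cv linearZ /= addr0 -scalerDl.
rewrite intrD mulrDl; congr ((_ + _) *: _).
by rewrite -[_%:~R]/((2 * m)%:R) -sqr_rt mulfK // rt_neq0.
Qed.

Lemma modes_charge l : has_charge m (- p%:Z + (2 * m * size l)%:Z) (modes l).
Proof.
elim: l => [|n l IH]; first by rewrite muln0 addr0; apply: has_charge_bvec.
have := has_charge_mode n%:Z IH.
by congr (has_charge m _ _); rewrite /=; lia.
Qed.

Lemma iter_mode0E k : iter k (a_ 0) vp = modes (nseq k 0%N).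
Proof. by elim: k => //= k ->. Qed.

Local Notation V_p := (@Vmp C m p).

Lemma Vmp_subspace : subspace V_p.
Proof. exact: poly_orbit_subspace. Qed.

(** This includes the modes of index n >= p, which vanish on V(p). *)
Lemma Vmp_mode n w : V_p w -> V_p (a_ n%:Z w).
Proof.
have [lt_np|le_pn] := ltnP n p.
  apply: (@poly_orbit_stable _ _ _ (fun i : 'I_p => a_ i%:Z)
    _ _ _ (Ordinal lt_np)) => [i|i j u].
    exact: linearP.
  exact: mode_comm.
have an0 u : V_p u -> a_ n%:Z u = 0.
  apply: (poly_orbit_ind (S := fun u => a_ n%:Z u = 0)) => [||i u' u'0].
  - split=> [|x u1 u2 u10 u20]; first exact: linear0.
    by rewrite linearP /= u10 u20 scaler0 addr0.
  - by apply: mode_ket_eq0; lia.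
  by rewrite mode_comm // u'0 linear0.
by move=> /an0 ->; case: Vmp_subspace.
Qed.

(** On products of modes applied to v_p, the operator h_(n+1) is a derivation up to
    the factor sqrt(2m): it kills v_p and raises one index of a mode by n+1. *)
Lemma Vmp_heis n w : V_p w -> V_p (h n.+1 w).
Proof.
have [V0 V_lin] := Vmp_subspace.
move=> V_w; suff [] : V_p w /\ V_p (h n.+1 w) by [].
move: w V_w.
apply: (poly_orbit_ind (S := fun w => V_p w /\ V_p (h n.+1 w))) => [||i w [Vw Vhw]].
- split=> [|x u v [Vu Vhu] [Vv Vhv]]; first by rewrite linear0.
  by rewrite linearP; split; apply: V_lin.
- by rewrite heis_ket; split=> //; apply: poly_orbit_base.
split; first exact: Vmp_mode.
rewrite heis_mode // addrC; apply: V_lin; last exact: Vmp_mode.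
by rewrite -PoszD; apply: Vmp_mode.
Qed.

(** A product of modes applied to v_p has a charge, which determines the number of
    modes. So a vector of V(p) with the charge of a_0^k v_p, being equal to its
    projection on this charge, is a combination of products of k modes. *)
Theorem Vmpc_orbit k :
  @Vmpc C m p (- p%:R / rt + k%:R * rt) = h_orbit k.
Proof.
pose c := - p%:Z + (2 * m * k)%:Z.
have -> : - p%:R / rt + k%:R * rt = c%:~R / rt.
  rewrite /c intrD mulrDl; congr (_ + _); first by rewrite rmorphN.
  by rewrite -[_%:~R]/((2 * m * k)%:R) natrM -sqr_rt mulrAC mulfK ?rt_neq0 // mulrC.
have charge_k : has_charge m c (iter k (a_ 0) vp).
  by have := modes_charge (nseq k 0%N); rewrite size_nseq -iter_mode0E.
apply/seteqP; split=> w /=.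
  move=> [V_w c_w]; have := charge_partE c c_w; rewrite eqxx => <-.
  case: V_w => q ->.
  have orb_sub : subspace (h_orbit k) by apply: poly_orbit_subspace.
  apply: (@subspace_linext _ _ (fun u => h_orbit k (charge_part c u))) => [|mu].
    case: orb_sub => orb0 orb_lin.
    split=> [|x u v orb_u orb_v]; first by rewrite linear0.
    by rewrite linearP; apply: orb_lin.
  have [l ->] : exists l, op_monom (fun i : 'I_p => a_ i%:Z) mu vp = modes l.
    apply: (op_monom_ind (S := fun u => exists l, u = modes l)); first by exists [::].
    by move=> i _ [l ->]; exists (nat_of_ord i :: l).
  rewrite (charge_partE c (modes_charge l)).
  case: eqP => [eq_c|_]; last by case: orb_sub.
  have -> : k = (0 + size l)%N by move: eq_c; rewrite /c; nia.
  exact: (modes_in_h_orbit l 0).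
have [V0 V_lin] := Vmp_subspace.
apply: (poly_orbit_ind (S := fun w => V_p w /\ has_charge m c w)) => [||n u [Vu cu]].
- split=> [|x u v [Vu cu] [Vv cv]]; first by rewrite /has_charge !linear0.
  split; first exact: V_lin.
  by rewrite /has_charge linearP /= cu cv scalerDr !scalerA mulrC.
- split=> //; rewrite iter_mode0E; elim: k {charge_k c} => [|k IH].
    exact: poly_orbit_base.
  exact: Vmp_mode.
by split; [apply: Vmp_heis | apply: has_charge_heis].
Qed.

End ModeProducts.

Theorem lemma2p4 (R : realType) (m p k : nat) (hm : (1 <= m)%N) (hp : (0 < p)%N) :
  @Vmpc R[i] m p (- p%:R / rt R[i] m + k%:R * rt R[i] m)
  = poly_orbit (fun n : nat => @heis R[i] m n.+1%:Z)
      (iter k (mode m 0) (vvec R[i] p%:Z)).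
Proof. exact: Vmpc_orbit. Qed.
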